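(* Let $L$ be the Kreweras–Lalanne involution on Dyck paths and $L'$ its derivative. For every $n\ge 3$, the permutation $L'\circ L$ of the set of Dyck $n$-paths has order $2n$.
   Context: A Dyck path is a lattice path with an equal number of upsteps $u=(1,1)$ and downsteps $d=(1,-1)$ that never dips below ground level, the horizontal line connecting its endpoints. Its size is its number of upsteps; a Dyck $n$-path is one of size $n$. The empty Dyck path is denoted $\epsilon$. A Dyck path is elevated if it is nonempty and its only return to ground level occurs at its end. Every nonempty Dyck path decomposes uniquely as a concatenation of elevated Dyck paths, called its components; each component has the form $u\,P\,d$ with $P$ a (possibly empty) Dyck path. Composition is $(f\circ g)(x)=f(g(x))$. The order of a permutation is its order as an element of the symmetric group. Partial-sum ascent-descent code. An ascent (descent) is a maximal sequence of contiguous upsteps (downsteps). For $n\ge 1$, let a Dyck $n$-path have $k$ peaks (occurrences of $ud$), ascent lengths $a_1,\dots,a_k$ and descent lengths $d_1,\dots,d_k$, in order. Put $r=k-1$, $A_i=\sum_{j\le i}a_j$ and $D_i=\sum_{j\le i}d_j$. The code of the path is the pair $\big((A_i)_{i=1}^{r},(D_i)_{i=1}^{r}\big)$. For given $n$ the path is determined by its code, and the codes of Dyck $n$-paths are exactly the pairs with $0\le r\le n-1$, $1\le A_1<\cdots<A_r\le n-1$, $1\le D_1<\cdots<D_r\le n-1$, and $A_i\ge D_i$ for $1\le i\le r$. Involution $L$. For a Dyck $n$-path $P$ with $n\ge 1$, label the upsteps $1,\dots,n$ from left to right and the downsteps $1,\dots,n$ from left to right. Let $D$ be the increasing sequence of labels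 of the first $u$ in each occurrence of $uu$ (two consecutive upsteps), and let $A$ be the increasing sequence of labels of the first $d$ in each occurrence of $dd$. These have the same length, and $(A,D)$ is a valid code. $L(P)$ is the Dyck $n$-path whose partial-sum ascent-descent code is $(A,D)$. Also $L(\epsilon)=\epsilon$. Derivative. $L'$ is defined by $L'(\epsilon)=\epsilon$ and $L'(uP_1d\;uP_2d\cdots uP_\ell d)=uL(P_1)d\;uL(P_2)d\cdots uL(P_\ell)d$, where $uP_1d,\dots,uP_\ell d$ are the components of the path. *)

(* Defs.v *)
From HB Require Import structures.
From mathcomp Require Import all_boot all_fingroup.

Set Implicit Arguments.
Unset Strict Implicit.
Unset Printing Implicit Defensive.

(* A lattice path is a [seq bool]: [true] is the upstep u, [false] is the     *)
(* downstep d.                                                                *)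

Definition is_dyck (s : seq bool) : bool :=
  (count_mem true s == count_mem false s) &&
  [forall i : 'I_(size s).+1,
     count_mem false (take i s) <= count_mem true (take i s)].

(* Dyck n-paths: as the numbers of u's and d's agree, a Dyck path with n      *)
(* upsteps is a Dyck path with 2n steps.                                      *)
Record dyck (n : nat) := Dyck {
  dyck_steps :> n.*2.-tuple bool;
  dyckP : is_dyck dyck_steps
}.

HB.instance Definition _ n := [isSub for @dyck_steps n].
HB.instance Definition _ n := [Finite of dyck n by <:].

Fixpoint runs (s : seq bool) : seq (bool * nat) :=
  if s is b :: s' then
    if runs s' is (c, m) :: t then
      if b == c then (c, m.+1) :: t else [:: (b, 1), (c, m) & t]
    else [:: (b, 1)]
  else [::].

Definition ascents (s : seq bool) : seq nat := [seq x.2 | x <- runs s & x.1].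
Definition descents (s : seq bool) : seq nat :=
  [seq x.2 | x <- runs s & ~~ x.1].

Definition npeaks (s : seq bool) : nat :=
  count (fun i => nth false s i && ~~ nth true s i.+1) (iota 0 (size s)).

(* The first [r] partial sums of [l], not including the empty one. *)
Definition partial_sums (r : nat) (l : seq nat) : seq nat :=
  [seq sumn (take i l) | i <- iota 1 r].

Definition code (s : seq bool) : seq nat * seq nat :=
  let r := (npeaks s).-1 in
  (partial_sums r (ascents s), partial_sums r (descents s)).

(* Labels of the first step of each (possibly overlapping) occurrence of two  *)
(* consecutive steps [b]; the label of the [b]-step at index i (from 0) is    *)
(* its rank, counted from 1, among the [b]-steps of the path.                 *)
Definition double_labels (b : bool) (s : seq bool) : seq nat :=
  [seq count_mem b (take i.+1 s) |
     i <- iota 0 (size s).-1 & (nth b s i == b) && (nth b s i.+1 == b)].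

Definition KL_code (s : seq bool) : seq nat * seq nat :=
  (double_labels false s, double_labels true s).

(* The Kreweras-Lalanne involution: [KL s] is the Dyck path of the same size  *)
(* as [s] with code [KL_code s]. For a Dyck path [s] there is exactly one     *)
(* such path (the default value [s] is only used when [s] is not Dyck); for   *)
(* [s] empty it is the empty path.                                            *)
Definition KL (s : seq bool) : seq bool :=
  if [pick q : (size s).-tuple bool | is_dyck q && (code q == KL_code s)]
    is Some q then tval q else s.

Definition elevate (s : seq bool) : seq bool := true :: rcons s false.

(* The interiors P_1, ..., P_l of the components of u P_1 d ... u P_l d,      *)
(* obtained by cutting the path at each return to ground level; [h] is the    *)
(* current height and [acc] the part already read of the current interior.    *)
Fixpoint interiors_rec (h : nat) (acc s : seq bool) : seq (seq bool) :=
  match s with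
  | [::] => [::]
  | true :: s' =>
      interiors_rec h.+1 (if h == 0 then acc else rcons acc true) s'
  | false :: s' =>
      if h <= 1 then acc :: interiors_rec 0 [::] s'
      else interiors_rec h.-1 (rcons acc false) s'
  end.

Definition interiors (s : seq bool) : seq (seq bool) := interiors_rec 0 [::] s.

Definition derivative (F : seq bool -> seq bool) (s : seq bool) : seq bool :=
  flatten [seq elevate (F p) | p <- interiors s].

Lemma interiors_rec_dyck (p : seq bool) (h : nat) (acc s : seq bool) :
    (forall i, count_mem false (take i p) <= count_mem true (take i p) + h) ->
  interiors_rec h.+1 acc (p ++ s) =
  interiors_rec (h.+1 + count_mem true p - count_mem false p) (acc ++ p) s.
Proof.
elim: p h acc => [|b p IHp] h acc Hp; first by rewrite /= cats0 addn0 subn0.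
case: b Hp => Hp /=.
- rewrite IHp => [|i]; last by have := Hp i.+1; rewrite /= add0n add1n addnS.
  by rewrite cat_rcons add1n add0n addnS.
- case: h Hp => [/(_ 1)|h Hp]; first by rewrite /= take0.
  rewrite IHp => [|i]; last by have := Hp i.+1; rewrite /= add0n add1n addnS.
  by rewrite cat_rcons add0n add1n addSn subSS.
Qed.

Lemma interiors_flatten (ps : seq (seq bool)) :
  all is_dyck ps -> interiors (flatten [seq elevate p | p <- ps]) = ps.
Proof.
rewrite /interiors; elim: ps => //= p ps IHps /andP[/andP[/eqP Ep /forallP Hp]].
move=> /IHps {}IHps; rewrite -cats1 -catA interiors_rec_dyck => [|i].
  by rewrite Ep addnK /= IHps.
rewrite addn0; case: (ltnP i (size p).+1) => [lt_ip|lt_pi].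
  exact: (Hp (Ordinal lt_ip)).
by rewrite take_oversize ?Ep // ltnW.
Qed.

Lemma derivativeE (F : seq bool -> seq bool) (ps : seq (seq bool)) :
    all is_dyck ps ->
  derivative F (flatten [seq elevate p | p <- ps]) =
  flatten [seq elevate (F p) | p <- ps].
Proof. by move=> /interiors_flatten; rewrite /derivative => ->. Qed.

(* Main.v *)
Require Import Defs.
From HB Require Import structures.
From mathcomp Require Import all_boot all_fingroup.
From mathcomp Require Import cyclic zify.

(** The map L' o L is rowmotion on the antichains of the root poset of type
A_(n-1), that is, of the intervals [a, b] with 1 <= a <= b <= n - 1 ordered by
inclusion; rowmotion has order 2n there because its n-th power is a reflection.

A path with code (A, D) is read as the antichain of the intervals [D_i, A_i].
For 1 <= j < n, the letter j is in A iff the j-th upstep is followed by a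
downstep, and dually for D, so L replaces (A, D) by the complements of D and A.
On codes, L' adds the returns to ground level to shifted complements
([derivative_KLP]).  Composing, L' o L moves every D_i one step to the left and
every A_i one step to the right, drops what leaves [1, n - 1], and inserts in
both sequences the points that no interval [D_i, A_i] contains
([derivative_KL_row]).  In terms of the lower set J of the intervals contained
in some [D_i, A_i] this is rowmotion: the new antichain consists of the minimal
intervals outside J ([row_matched], [covers_row]).

Let J_k be the lower set after k steps.  The rule that determines J_(k+1) from
J_k is local and is a thresholded form of the recurrence
d(i+1,j+1) = | d(i+1,j) + d(i,j+1) - d(i,j) |, where [a, b] belongs to J_k iff
d(k-b, k+a) > b - a.  This recurrence is solved by the distance in a plane tree
with n edges between the corners i and j met when walking around the tree
([tdist], [tdist_local]).  The tree itself is found from the orbit: its contour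
walk is the boundary of the staircase of the pairs (a, b) with [a, b] in J_b
([ups], [upsP]).  Hence J_k is given by a tree distance for all k in [0, n]
([flow_after], [flow_before]).  A contour has 2n corners and distance is
symmetric, so that d(n-b, n+a) = d(-(n-a), n-b): the interval [a, b] is in J_n
iff [n-b, n-a] is in J_0 ([flow_reflect]).  As J determines the code
([covers_inj]), the 2n-th iterate is the identity ([rowmotion_period]).

The order is no smaller.  The orbit of u^n d^n does not return before n steps,
since J_0 is empty and J_k, for 0 < k < n, is not ([flow_from_empty]).  The
n-th power is not the identity: it reflects the antichain whose only interval is
[1, 1] to the one with [n-1, n-1], and n >= 3.  An order that divides 2n, is at
least n and is not n equals 2n. *)

(** * Distances along the contour of a plane tree, and rowmotion *)

(** Minimum of [h] on the integer interval [i, i + l]. *)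
Fixpoint low (h : nat -> nat) (i l : nat) : nat :=
  if l is l'.+1 then minn (h i) (low h i.+1 l') else h i.

(** If [h] is the depth along the contour of a plane tree, this is the distance
in the tree between the corners [i] and [j], for [i <= j]: the minimum of [h]
in between is the depth of their last common ancestor. *)
Definition tdist (h : nat -> nat) (i j : nat) : nat :=
  h i + h j - 2 * low h i (j - i).

Lemma lowSr h i l : low h i l.+1 = minn (low h i l) (h (i + l.+1)).
Proof.
elim: l i => [|l IHl] i; first by rewrite /= addn1.
by rewrite /= -minnA -addSnnS -IHl.
Qed.

Lemma low_le h i l : low h i l <= h i /\ low h i l <= h (i + l).
Proof.
elim: l i => [|l IHl] i /=; first by rewrite addn0.
by have := IHl i.+1; rewrite addSnnS; lia.
Qed.

(** Depth functions of the contours of the plane trees with [n] edges; these are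
the height functions of the Dyck [n]-paths. *)
Definition contour (n : nat) (h : nat -> nat) : Prop :=
  [/\ h 0 = 0, h (2 * n) = 0 &
      forall j, j < 2 * n -> h j.+1 = (h j).+1 \/ h j = (h j.+1).+1].

(** The number [u] of upsteps before time [j] carries at once the parity of the
height and its bounds [j] and [2 * n - j]. *)
Lemma contour_bound n h j : contour n h -> j <= 2 * n ->
  exists2 u, h j + j = 2 * u & j <= 2 * u <= 2 * n /\ u <= j.
Proof.
case=> h0 hn hS; rewrite leq_eqVlt => /predU1P [->|lt_j].
  by exists n; [lia | split; lia].
have up : forall i, i <= 2 * n -> exists2 u, h i + i = 2 * u & u <= i.
  elim=> [|i IHi] le_i; first by exists 0; lia.
  have [u eu le_u] := IHi (ltnW le_i).
  case: (hS i le_i) => e; first by exists u.+1; lia.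
  by exists u; lia.
have down : forall i, i <= 2 * n -> h (2 * n - i) <= i.
  elim=> [|i IHi] le_i; first by rewrite subn0 hn.
  have := hS (2 * n - i.+1); rewrite -subSn // subSS.
  by have := IHi (ltnW le_i); lia.
have [u eu le_u] := up j (ltnW lt_j).
have := down (2 * n - j) (leq_subr _ _); rewrite subKn ?(ltnW lt_j) // => dj.
by exists u; lia.
Qed.

(** Moving either corner by one step changes a distance by one, and the first
clause says that Y = | U + V - X |.  The exception to X + Y = U + V arises when
the edge followed from [i] to [i + 1] is the one followed back from [j] to
[j + 1]: then [i] and [j + 1] sit at the same vertex, as do [i + 1] and [j]. *)
Lemma tdist_local n h i j : contour n h -> i < j -> j < 2 * n ->
  let X := tdist h i j in let U := tdist h i.+1 j in
  let V := tdist h i j.+1 in let Y := tdist h i.+1 j.+1 in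
  [/\ X + Y = U + V \/ X = 1 /\ Y = 1 /\ U = 0 /\ V = 0,
      U = X.+1 \/ X = U.+1, V = X.+1 \/ X = V.+1, U = Y.+1 \/ Y = U.+1
    & V = Y.+1 \/ Y = V.+1].
Proof.
move=> wh lt_ij lt_j /=; have [_ _ hS] := wh.
have hi := hS i (ltn_trans lt_ij lt_j); have hj := hS j lt_j.
rewrite /tdist subSS.
have -> : j.+1 - i = (j - i.+1).+2 by lia.
have -> : j - i = (j - i.+1).+1 by lia.
set l := j - i.+1.
have -> : low h i l.+2 = minn (h i) (minn (low h i.+1 l) (h j.+1)).
  by rewrite [low h i _]/= -/(low h i.+1 l.+1) lowSr /l; congr (minn _ (minn _ (h _))); lia.
have -> : low h i l.+1 = minn (h i) (low h i.+1 l) by [].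
have -> : low h i.+1 l.+1 = minn (low h i.+1 l) (h j.+1).
  by rewrite lowSr /l; congr (minn _ (h _)); lia.
have := low_le h i.+1 l; rewrite /l subnKC //.
move: (low h i.+1 _) (h i) (h i.+1) (h j) (h j.+1) hi hj => m hi hi1 hj hj1.
by move=> {lt_ij lt_j hS wh l} H1 H2 [H3 H4]; split; lia.
Qed.

Lemma tdist_le n h i j : contour n h -> i <= j -> j <= 2 * n ->
  tdist h i j <= j - i /\ tdist h i j + j <= 2 * n + i.
Proof.
move=> wh le_ij le_j; split; last first.
  have [u eu [b1 b2]] := contour_bound n h i wh (leq_trans le_ij le_j).
  have [v ev [b3 b4]] := contour_bound n h j wh le_j.
  by rewrite /tdist; lia.
have [_ _ hS] := wh.
suff: forall l i, i + l <= 2 * n -> h i + h (i + l) <= 2 * low h i l + l.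
  by move/(_ (j - i) i); rewrite /tdist subnKC // => /(_ le_j); lia.
elim=> [|l IHl] {i j le_ij le_j} i le_il; first by rewrite /= addn0; lia.
have := IHl i.+1; rewrite addSnnS /= => /(_ le_il).
have [le1 le2] := low_le h i.+1 l.
have hi : i < 2 * n by lia.
have := hS i hi.
have [_] := low_le h i l.+1; rewrite /= => le3.
suff: h (i + l.+1) <= h i + l.+1 by lia.
elim: (l.+1) le_il {IHl le2 le3 le1} => [|r IHr] le_ir; first by rewrite !addn0.
have := hS (i + r); rewrite -addnS => /(_ le_ir).
by have := IHr (ltac:(lia)); lia.
Qed.

Lemma tdist0 n h j : contour n h -> j <= 2 * n -> tdist h 0 j = h j.
Proof.
by case=> h0 _ _ _; rewrite /tdist; have [] := low_le h 0 (j - 0); rewrite h0; lia.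
Qed.

Lemma tdist2n n h j : contour n h -> j <= 2 * n -> tdist h j (2 * n) = h j.
Proof.
case=> _ h2n _ le_j; rewrite /tdist.
by have [_] := low_le h j (2 * n - j); rewrite subnKC // h2n; lia.
Qed.

(** [J k a b] says that the interval [a, b] lies in the lower set at time [k].
The conventions [flow_true], [flow_left] and [flow_right] extend this to all
pairs, so that the local rule [flow_row] needs no case distinction at the
border.  The rule toggles the intervals from the longest to the shortest: an
interval is in the next lower set iff one of its two one-point extensions
is, or it is a minimal interval outside of the present lower set. *)
Record rowmotion_flow (n : nat) (J : nat -> nat -> nat -> bool) : Prop := {
  flow_true : forall k a b, b < a -> J k a b;
  flow_left : forall k b, J k 0 b = false;
  flow_right : forall k a b, a <= b -> n <= b -> J k a b = false;
  flow_incl : forall k a b, J k a b -> J k a.+1 b;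
  flow_incr : forall k a b, J k a b.+1 -> J k a b;
  flow_row : forall k a b, 0 < a -> a <= b -> b < n ->
    J k.+1 a b = [|| J k.+1 a.-1 b, J k.+1 a b.+1
                   | [&& ~~ J k a b, J k a.+1 b & J k a b.-1]]
}.

(** An interval of the new lower set is contained in a minimal interval outside
of the old one, so that removing either endpoint lands in the old lower set. *)
Lemma flow_shrink n J k a b : rowmotion_flow n J ->
  (J k.+1 a b -> J k a.+1 b) /\ (J k.+1 a b -> J k a b.-1).
Proof.
move=> flJ.
suff: forall c a b, a + (n - b) <= c -> J k.+1 a b -> J k a.+1 b /\ J k a b.-1.
  by move/(_ _ a b (leqnn _)) => H; split=> /H [].
elim=> [|c IHc] {}a {}b; first by case: a => [|a] // _; rewrite (flow_left _ _ flJ).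
case: (posnP a) => [-> _|a_gt0 le_c]; first by rewrite (flow_left _ _ flJ).
case: (ltnP b a) => [lt_ba _|le_ab].
  by split; apply: flow_true flJ _ _ _ _; lia.
case: (ltnP b n) => [lt_bn|le_nb]; last by rewrite (flow_right _ _ flJ).
(* by induction for a longer interval; otherwise [a, b] itself is minimal *)
rewrite (flow_row _ _ flJ) // => /or3P [J1|J1|/and3P []] //.
  have [] := IHc a.-1 b _ J1; first lia.
  rewrite prednK // => H1 H2; split; first exact: flow_incl flJ _ _ _ H1.
  by have := flow_incl _ _ flJ _ _ _ H2; rewrite prednK.
have [] := IHc a b.+1 _ J1; first lia.
move=> H1 H2; split; first exact: flow_incr flJ _ _ _ H1.
by case: b H2 {J1 H1 le_ab lt_bn le_c} => [|b] //; exact: flow_incr flJ _ _ _.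
Qed.

(** The pairs [(a, b)] with [J b a b] form a staircase, since this property is
preserved by increasing [a] and by decreasing [b].  [ups J j] counts the
upsteps among the first [j] steps of the boundary of the staircase: at a point
with [u] upsteps and [j - u] downsteps, the path looks at the next pair of the
staircase. *)
Fixpoint ups (J : nat -> nat -> nat -> bool) (j : nat) : nat :=
  if j is j'.+1 then ups J j' + J (ups J j') (j - ups J j') (ups J j') else 0.

Lemma upsP n J j : rowmotion_flow n J ->
  ups J j <= j /\ forall b, b <= j -> J b (j - b) b = (b < ups J j).
Proof.
move=> flJ; elim: j => [|j [le_u IHj]].
  by split=> // b; rewrite leqn0 => /eqP->; rewrite (flow_left _ _ flJ).
rewrite [ups J j.+1]/=; set u := ups J j in le_u IHj *.
split=> [|b le_b]; first by case: (J _ _ _); lia.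
case: (ltngtP b u) => [lt_bu|lt_ub|->]; last first.
- by case: (J _ _ _); lia.
- have e : J b (j.+1 - b) b = false.
    apply/negbTE/negP.
    have [_] := flow_shrink n J b.-1 (j.+1 - b) b flJ.
    rewrite prednK; last lia.
    move=> H /H; have -> : j.+1 - b = j - b.-1 by lia.
    by rewrite IHj; lia.
  by rewrite e; case: (J _ _ _); lia.
- rewrite subSn; last lia.
  rewrite (flow_incl _ _ flJ); first by case: (J _ _ _); lia.
  by rewrite IHj //; lia.
Qed.

Definition flow_height J j := 2 * ups J j - j.

Lemma ups_bounds n J j : rowmotion_flow n J -> j <= 2 * n ->
  j <= 2 * ups J j /\ ups J j <= n.
Proof.
move=> flJ le_j; have [le_u uP] := upsP n J j flJ; split.
  rewrite leqNgt; apply/negP => lt_u; have := uP _ le_u.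
  by rewrite (flow_true _ _ flJ) ?ltnn //; lia.
rewrite leqNgt; apply/negP => lt_n; have := uP n (leq_trans (ltnW lt_n) le_u).
by rewrite (flow_right _ _ flJ) ?lt_n //; lia.
Qed.

Lemma flow_height_contour n J : rowmotion_flow n J -> contour n (flow_height J).
Proof.
move=> flJ; rewrite /flow_height; split=> //.
  by have := ups_bounds n J (2 * n) flJ (leqnn _); lia.
move=> j lt_j; have := ups_bounds n J j flJ (ltnW lt_j).
have := ups_bounds n J j.+1 flJ lt_j.
by rewrite [ups J j.+1]/=; case: (J _ _ _); lia.
Qed.

(** The threshold formula holds on the diagonal [k = b] by the choice of the
contour: there one of the corners is the root. *)
Lemma flow_base n J a b : rowmotion_flow n J -> a + b <= 2 * n ->
  J b a b = (b < flow_height J (a + b) + a).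
Proof.
move=> flJ le_ab; have [_ /(_ b (leq_addl _ _))] := upsP n J (a + b) flJ.
rewrite addnK => ->; have := ups_bounds n J (a + b) flJ le_ab.
by rewrite /flow_height; lia.
Qed.

(** The row rule is a thresholded form of [tdist_local], and both sides agree on
the diagonal [k = b]; the formula then propagates to later times. *)
Lemma flow_after n J k a b : rowmotion_flow n J -> b <= k -> k + a <= 2 * n ->
  J k a b = (b < tdist (flow_height J) (k - b) (k + a) + a).
Proof.
move=> flJ; have wh := flow_height_contour n J flJ.
set h := flow_height J in wh *.
move e : (k - b) => i; elim: i => [|i IHi] in k a b e *.
  move=> le_bk le_ka; have ->: k = b by lia.
  by rewrite (flow_base n) ?(tdist0 n) // 1?[b + a]addnC //; lia.
move c : (a + b) => d; elim: d => [|d IHd] in k a b e c * => le_bk le_ka.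
  have [-> ->] : a = 0 /\ b = 0 by lia.
  rewrite (flow_left _ _ flJ) /tdist.
  by have -> : i.+1 = k + 0; [lia | rewrite subnn /=; lia].
have [td1 td2] := tdist_le n h i.+1 (k + a) wh (ltac:(lia)) le_ka.
case: (posnP a) => [a0|a_gt0]; first by rewrite a0 (flow_left _ _ flJ) -a0; lia.
case: (ltnP b a) => [lt_ba|le_ab]; first by rewrite (flow_true _ _ flJ) //; lia.
case: (ltnP b n) => [lt_bn|le_nb]; last by rewrite (flow_right _ _ flJ) //; lia.
case: k => [|k] in e le_bk le_ka td1 td2 *; first by lia.
have bk : b <= k by lia.
rewrite (flow_row _ _ flJ) //.
rewrite (IHd k.+1 a.-1 b); [|lia..].
rewrite (IHi k.+1 a b.+1); [|lia..].
rewrite (IHi k a b); [|lia..].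
rewrite (IHi k a.+1 b); [|lia..].
rewrite (IHd k a b.-1); [|lia..].
have [] := tdist_local n h i (k + a) wh (ltac:(lia)) (ltac:(lia)).
have -> : k.+1 + a.-1 = k + a by lia.
have -> : k.+1 + a = (k + a).+1 by lia.
have -> : k + a.+1 = (k + a).+1 by lia.
have [td3 _] := tdist_le n h i (k + a) wh (ltac:(lia)) (ltac:(lia)).
have [v ev _] := contour_bound n h i wh (ltac:(lia)).
have [w ew _] := contour_bound n h (k + a) wh (ltac:(lia)).
have [l1 l2] := low_le h i (k + a - i).
have : tdist h i (k + a) = h i + h (k + a) - 2 * low h i (k + a - i) by [].
rewrite subnKC in l2; last lia.
move: (tdist h i (k + a)) (tdist _ i.+1 (k + a)) (tdist _ i (k + a).+1) (tdist _ i.+1 (k + a).+1)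
  (low h i _) (h i) (h (k + a)) l1 l2 ev ew.
move=> X U V Y m hi hj l1 l2 ev ew eX; lia.
Qed.

(** Before the diagonal the left corner [k - b] is negative and is replaced by
[2 * n + k - b], which changes the order of the two corners.  Here the local
rule is solved for the interval at the earlier time, so that the induction runs
backwards. *)
Lemma flow_before n J k a b : rowmotion_flow n J -> k <= b -> a + b <= 2 * n ->
  J k a b = (b < tdist (flow_height J) (k + a) (2 * n + k - b) + a).
Proof.
move=> flJ; have wh := flow_height_contour n J flJ.
set h := flow_height J in wh *.
move e : (b - k) => i; elim: i => [|i IHi] in k a b e *.
  move=> le_bk le_ab; have ->: k = b by lia.
  rewrite (flow_base n) // addnK (tdist2n n) //; last lia.
  by rewrite [b + a]addnC.
move c : (2 * n - (a + b)) => d; elim: d => [|d IHd] in k a b e c * => le_bk le_ab.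
  have [td1 _] := tdist_le n h (k + a) (2 * n + k - b) wh (ltac:(lia)) (ltac:(lia)).
  case: (ltnP b a) => [lt_ba|le_ab']; first by rewrite (flow_true _ _ flJ) //; lia.
  by rewrite (flow_right _ _ flJ) //; lia.
have [td1 td2] := tdist_le n h (k + a) (2 * n + k - b) wh (ltac:(lia)) (ltac:(lia)).
case: (posnP a) => [a0|a_gt0].
  have -> : J k a b = false by rewrite a0 (flow_left _ _ flJ).
  apply/esym/negbTE; rewrite -leqNgt; lia.
case: (ltnP b a) => [lt_ba|le_ab']; first by rewrite (flow_true _ _ flJ) //; lia.
case: (ltnP b n) => [lt_bn|le_nb]; last by rewrite (flow_right _ _ flJ) //; lia.
have := flow_row _ _ flJ k a b a_gt0 le_ab' lt_bn.
have := flow_shrink n J k a.-1 b flJ; rewrite prednK // => -[sh1 _].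
have [_ sh2] := flow_shrink n J k a b.+1 flJ.
have := flow_incl _ _ flJ k a b.
have := flow_incr _ _ flJ k a b.-1; rewrite prednK; last lia.
move: sh1 sh2.
rewrite (IHi k.+1 a b); [|lia..].
rewrite (IHi k.+1 a.-1 b); [|lia..].
rewrite (IHd k.+1 a b.+1); [|lia..].
rewrite (IHd k a.+1 b); [|lia..].
rewrite (IHi k a b.-1); [|lia..].
set p := k + a; set q := 2 * n + k - b.
have [] := tdist_local n h p q wh (ltac:(lia)) (ltac:(lia)).
have -> : k.+1 + a = p.+1 by lia.
have -> : 2 * n + k.+1 - b = q.+1 by lia.
have -> : k.+1 + a.-1 = p by lia.
have -> : 2 * n + k.+1 - b.+1 = q by lia.
have -> : k + a.+1 = p.+1 by lia.
have -> : 2 * n + k - b.-1 = q.+1 by lia.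
have [v ev _] := contour_bound n h p wh (ltac:(lia)).
have [w ew _] := contour_bound n h q wh (ltac:(lia)).
have [l1 l2] := low_le h p (q - p).
have : tdist h p q = h p + h q - 2 * low h p (q - p) by [].
rewrite subnKC in l2; last lia.
have epq : p + q + b = 2 * n + 2 * k + a by lia.
(* only the parity of the distance matters in the comparison with [b - a] *)
move=> eX; have {eX} eX : tdist h p q + a + 2 * (low h p (q - p) + n + k) = 2 * (v + w) + b.
  by rewrite eX; lia.
move: (J k a b) (tdist h p q) (tdist _ p.+1 q) (tdist _ p q.+1) (tdist _ p.+1 q.+1)
  (low h p _ + _ + _) (v + w) eX.
move=> z X U V Y s t eX rel UX VX UY VY; clear -a_gt0 le_ab' eX rel UX VX UY VY.
move=> sh1 sh2 m1 m2 r.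
apply/idP/idP; lia.
Qed.

(** The corners of [a, b] at time [n] and those of [n - b, n - a] at time [0] are
the same pair. *)
Theorem flow_reflect n J a b : rowmotion_flow n J -> a <= b -> b <= n ->
  J n a b = J 0 (n - b) (n - a).
Proof.
move=> flJ le_ab le_bn.
rewrite (flow_after n) ?(flow_before n) //; [|lia..].
have -> : 0 + (n - b) = n - b by lia.
have -> : 2 * n + 0 - (n - a) = n + a by lia.
by apply/idP/idP; lia.
Qed.

(** From the empty set, rowmotion adds the intervals by increasing length. *)
Lemma flow_from_empty n J k a b : rowmotion_flow n J ->
    (forall a b, 0 < a <= b -> J 0 a b = false) ->
  k < n -> 0 < a -> a <= b -> b < n -> J k a b = (b < a + k).
Proof.
move=> flJ J0; elim: k a b => [|k IHk] a b lt_kn a_gt0 le_ab lt_bn.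
  by rewrite J0 ?a_gt0 //; lia.
have {}IHk a' b' : 0 < a' -> b' < n -> J k a' b' = (b' < a' + k).
  move=> ? ?; case: (ltnP b' a') => [lt_ba|?]; last by rewrite IHk //; lia.
  by rewrite (flow_true _ _ flJ) //; lia.
move c : (a + (n - b)) => r; elim: r => [|r IHr] in a b c a_gt0 le_ab lt_bn *.
  by lia.
rewrite (flow_row _ _ flJ) // !IHk; [|lia..].
have -> : J k.+1 a.-1 b = (0 < a.-1) && (b < a.-1 + k.+1).
  by case: (posnP a.-1) => [->|?]; rewrite ?(flow_left _ _ flJ) //= IHr //; lia.
have -> : J k.+1 a b.+1 = (b.+1 < n) && (b.+1 < a + k.+1).
  case: (ltnP b.+1 n) => [?|?]; first by rewrite IHr //; lia.
  by rewrite (flow_right _ _ flJ) //; lia.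
by apply/idP/idP; lia.
Qed.

(** * Rowmotion on codes *)

(** The number of letters [j] of the set [a] with [1 <= j <= m]. *)
Definition cnt (a : nat -> bool) (m : nat) : nat := count a (iota 1 m).

Lemma cntS a m : cnt a m.+1 = cnt a m + a m.+1.
Proof. by rewrite /cnt -(addn1 m) iotaD count_cat /= addn0 add1n addn1. Qed.

Lemma cnt_pred a m : 0 < m -> cnt a m = cnt a m.-1 + a m.
Proof. by case: m => // m _; rewrite cntS. Qed.

Lemma leq_cnt a m1 m2 : m1 <= m2 -> cnt a m1 <= cnt a m2.
Proof. by move=> /subnKC <-; rewrite /cnt iotaD count_cat leq_addr. Qed.

(** The sets [al] and [de] are the two halves A and D of a code: equally many
letters of [1, n - 1], with A_i >= D_i stated through the counting functions. *)
Definition is_code (n : nat) (al de : nat -> bool) : Prop :=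
  [/\ forall j, al j -> 0 < j < n, forall j, de j -> 0 < j < n,
      forall m, cnt al m <= cnt de m & cnt al n = cnt de n].

(** For [a <= b], the interval [a, b] is contained in some [D_i, A_i]: the last
[i] with D_i <= a must satisfy b <= A_i. *)
Definition covers (al de : nat -> bool) (a b : nat) : bool :=
  (b < a) || (cnt al b.-1 < cnt de a).

(** The negation of [covers al de j j]. *)
Definition uncovered (al de : nat -> bool) (j : nat) : bool :=
  cnt de j <= cnt al j.-1.

(** Left endpoints move left, right endpoints move right, and each uncovered
point becomes an interval.  For [j = 1] and [j = n - 1] the letters [0] and [n]
are read; they are in neither set. *)
Definition row_code (n : nat) (al de al2 de2 : nat -> bool) : Prop :=
  forall j, 0 < j < n ->
    al2 j = al j.-1 || uncovered al de j /\ de2 j = de j.+1 || uncovered al de j.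

Lemma cnt_support n (f : nat -> bool) m : (forall j, f j -> 0 < j < n) -> n.-1 <= m ->
  cnt f m = cnt f n.-1.
Proof.
move=> f_lt /subnKC <-; elim: (m - n.-1) => [|i IHi]; first by rewrite addn0.
by rewrite addnS cntS IHi; case: (boolP (f _)) => [/f_lt|]; lia.
Qed.

Lemma eq_cnt (a1 a2 : nat -> bool) m :
  (forall j, 0 < j <= m -> a1 j = a2 j) -> cnt a1 m = cnt a2 m.
Proof. by move=> e; apply: eq_in_count => j; rewrite mem_iota => ?; apply: e; lia. Qed.

Lemma cntD (a : nat -> bool) m1 m2 :
  cnt a (m1 + m2) = cnt a m1 + cnt (fun j => a (m1 + j)) m2.
Proof.
by elim: m2 => [|m2 IHm]; rewrite ?addn0 // addnS !cntS IHm addnS addnA.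
Qed.

Lemma cnt_shift (a : nat -> bool) m : ~~ a 0 -> cnt (fun j => a j.-1) m = cnt a m.-1.
Proof.
move=> a0; case: m => [|m] //=; elim: m => [|m IHm].
  by rewrite /cnt /= (negbTE a0).
by rewrite cntS IHm cntS.
Qed.

Lemma cnt_compl n (f : nat -> bool) m : (forall j, f j -> 0 < j < n) ->
  cnt (fun j => (0 < j < n) && ~~ f j) m + cnt f m = minn m n.-1.
Proof.
move=> f_lt; elim: m => [|m IHm]; first by rewrite min0n.
rewrite !cntS addnACA IHm.
by case: (boolP (f _)) => [/f_lt|]; rewrite ?andbF ?andbT /=; lia.
Qed.

Lemma is_code_compl n al de : is_code n al de ->
  is_code n (fun j => (0 < j < n) && ~~ de j) (fun j => (0 < j < n) && ~~ al j).
Proof.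
move=> [al_lt de_lt valid total].
by split=> [j /andP [] //|j /andP [] //|m|];
  [have := cnt_compl n de m de_lt; have := cnt_compl n al m al_lt; have := valid m
  |have := cnt_compl n de n de_lt; have := cnt_compl n al n al_lt]; lia.
Qed.

Section RowCode.
Variables (n : nat) (al de al2 de2 : nat -> bool).
Hypothesis cd : is_code n al de.
Hypothesis row : row_code n al de al2 de2.

Let births m := cnt (fun j => uncovered al de j && ~~ al j.-1) m.

Lemma birthsS m : births m.+1 = births m + (uncovered al de m.+1 && ~~ al m).
Proof. by rewrite /births cntS. Qed.

(** The maximal runs of uncovered points start right after a right endpoint or
at [1], and end right before a left endpoint or at [n - 1].  A right endpoint
that meets an uncovered point when it moves thus meets the first point of a run;
[births] counts the uncovered points that are not met in this way. *)
Lemma cnt_al2 m : m < n -> cnt al2 m = cnt al m.-1 + births m.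
Proof.
have [al_lt _ _ _] := cd.
elim: m => [|m IHm] lt_mn //.
rewrite cntS IHm; last lia.
have [-> _] := row m.+1 (ltac:(lia)).
rewrite /births cntS /=; case: m {IHm lt_mn} => [|m] /=.
  by rewrite /cnt /=; case: (boolP (al 0)) => [/al_lt|]; case: (uncovered _ _ _); lia.
by rewrite (cntS al m); case: (al _); case: (uncovered _ _ _); lia.
Qed.

(** The counterpart of [cnt_al2] for left endpoints.  The summand 1 on the
left stands for the letter [1]: it is lost if it is a left endpoint, and
otherwise it starts a run without a right endpoint before it.  The correction on
the right is one when [m] lies in a run that continues at [m + 1]: this run has
met the right endpoint before its start, but not the left one after its end. *)
Lemma cnt_de2 m : m < n ->
  cnt de2 m + 1 = cnt de m.+1 + births m + (uncovered al de m && ~~ de m.+1).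
Proof.
have [al_lt de_lt valid _] := cd.
elim: m => [|m IHm] lt_mn.
  by rewrite /births cntS /uncovered /cnt /=; case: (de 1).
have al_m : cnt al m = cnt al m.-1 + al m.
  by case: (m) => [|i]; rewrite ?cntS //=; case: (boolP (al 0)) => // /al_lt.
have := IHm (ltnW lt_mn); rewrite {IHm} (cntS de2 m) (cntS de m.+1) birthsS.
have [_ ->] := row m.+1 (ltac:(lia)).
rewrite /uncovered /= (cntS de m) al_m.
have := valid m; rewrite al_m; move: (cnt _ m) (cnt al _) (cnt de _) => c c1 c2.
by case: (de m.+1); case: (de m.+2); case: (al m); rewrite ?andbT ?andbF /=; lia.
Qed.

Lemma leq_births m1 m2 : m1 <= m2 -> births m1 <= births m2.
Proof. exact: leq_cnt. Qed.

Lemma births_const m1 m2 : m1 <= m2 ->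
  (forall j, m1 < j <= m2 -> ~~ uncovered al de j) -> births m2 = births m1.
Proof.
move=> /subnKC <-; elim: (m2 - m1) => [|i IHi] nf; first by rewrite addn0.
rewrite addnS birthsS IHi => [|j lt_j]; last by apply: nf; lia.
by rewrite (negbTE (nf _ _)) ?addn0 //; lia.
Qed.

Lemma births_lt m1 m2 : births m1 < births m2 ->
  exists j, [/\ m1 < j, j <= m2, uncovered al de j & ~~ al j.-1].
Proof.
move=> lt_b; have le_m : m1 <= m2.
  by rewrite leqNgt; apply/negP => /ltnW /leq_births; lia.
move: lt_b; rewrite -(subnKC le_m); elim: (m2 - m1) => [|i IHi].
  by rewrite addn0 ltnn.
rewrite addnS birthsS.
case: (boolP (_ && _)) => [/andP [H1 H2] _|_]; first by exists (m1 + i).+1; split=> //; lia.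
by rewrite addn0 => /IHi [j [? ? ? ?]]; exists j; split=> //; lia.
Qed.

(** The left side says that [a, b] is an interval of the new antichain, the right
side that it is minimal outside of the old lower set. *)
Lemma row_matched a b : 0 < a -> a <= b -> b < n ->
  [&& de2 a, al2 b & cnt de2 a == cnt al2 b] =
  [&& ~~ covers al de a b, covers al de a.+1 b & covers al de a b.-1].
Proof.
move=> a_gt0 le_ab lt_bn.
have [al_lt de_lt valid _] := cd.
have [_ ea] := row a (ltac:(lia)).
have [eb _] := row b (ltac:(lia)).
have ca := cnt_de2 a (ltac:(lia)).
have cb := cnt_al2 b lt_bn.
have va := valid a.
have Lb : births a <= births b by apply: leq_births.
apply/idP/idP.
- case/and3P=> dea alb /eqP ecab.
  have eqa : cnt de2 a = cnt de a + births a.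
    move: ca dea; rewrite cntS ea.
    by case: (de a.+1); case: (uncovered _ _ _); rewrite /=; lia.
  rewrite eqa cb in ecab.
  have eqb : births b = births a.
    apply/eqP; rewrite eqn_leq Lb andbT leqNgt; apply/negP => lt_b.
    have [j [lt1 lt2 fj _]] := births_lt _ _ lt_b.
    have := @leq_cnt al j.-1 b.-1 (ltac:(lia)).
    have := @leq_cnt de a j (ltac:(lia)).
    by move: fj; rewrite /uncovered; lia.
  have ecd : cnt de a = cnt al b.-1 by lia.
  rewrite /covers; case: (ltngtP a b) le_ab => [lt_ab|//|eab] _; last first.
    by rewrite eab leqnn prednK ?leqnn ?ltnn /= -?eab // ecd -eab ltnn.
  have {}eb : al b.-1.
    apply: contraLR alb => nalb; rewrite eb (negbTE nalb) /=.
    apply/negP => fb.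
    have : births b = births b.-1 + 1.
      rewrite -{1}(prednK (leq_trans a_gt0 (ltnW lt_ab))) birthsS.
      by rewrite prednK ?fb ?nalb //; lia.
    by have := @leq_births a b.-1 (ltac:(lia)); lia.
  have sb : cnt al b.-1 = cnt al b.-2 + 1.
    by rewrite cnt_pred ?eb //; lia.
  have {}ea : de a.+1.
    move: dea; rewrite ea => /orP [//|]; rewrite /uncovered => fa.
    by have := @leq_cnt al a.-1 b.-2 (ltac:(lia)); lia.
  by rewrite cntS ea; lia.
- rewrite /covers => /and3P [].
  have al_a : cnt al a.-1 <= cnt al a by apply: leq_cnt; lia.
  case: (ltngtP a b) le_ab => [lt_ab|//|eab] _; last first.
    subst b; rewrite /= -leqNgt => fa _ _.
    have fra : uncovered al de a by [].
    rewrite ea eb fra !orbT /=; move: ca; rewrite cntS fra.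
    by case: (de a.+1); rewrite /=; lia.
  rewrite ltnS (leqNgt b) lt_ab /= -leqNgt => c1 c2 c3.
  have sb : cnt al b.-1 = cnt al b.-2 + al b.-1.
    by rewrite cnt_pred //; lia.
  rewrite cntS in c2.
  have deS : de a.+1 by move: c2; case: (de _) => //=; lia.
  have alP : al b.-1 by move: sb; case: (al _) => //=; lia.
  rewrite ea eb deS alP /=.
  have eqb : births b = births a.
    apply: births_const => [|j lt_j]; first by lia.
    rewrite /uncovered -ltnNge.
    have := @leq_cnt al j.-1 b.-1 (ltac:(lia)).
    by have := @leq_cnt de a.+1 j (ltac:(lia)); rewrite cntS; lia.
  by move: ca; rewrite cntS deS andbF /=; lia.
Qed.

(** An interval that is in the new lower set but neither of whose one-point
extensions is in it belongs to the new antichain. *)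
Lemma covers_row a b : 0 < a -> a <= b -> b < n ->
  covers al2 de2 a b = [|| covers al2 de2 a.-1 b, covers al2 de2 a b.+1
    | [&& ~~ covers al de a b, covers al de a.+1 b & covers al de a b.-1]].
Proof.
move=> a_gt0 le_ab lt_bn; rewrite -row_matched // /covers.
have -> : b < a = false by lia.
have -> : b < a.-1 = false by lia.
have -> : b.+1 < a = false by lia.
rewrite /= (cnt_pred de2 _ a_gt0) (cnt_pred al2 _ (leq_trans a_gt0 le_ab)).
by case: (de2 _); case: (al2 _); rewrite /=; lia.
Qed.

End RowCode.

(** A letter [a] of D is seen in the lower set: [a, b] lies in it and its
extension to the left does not, when [b] is the partner of [a]. *)
Lemma de_covers n al de a : is_code n al de ->
  de a <-> exists b, [/\ 0 < a, a <= b, covers al de a b & ~~ covers al de a.-1 b].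
Proof.
move=> [_ de_lt valid total]; split=> [de_a|[b [a_gt0 le_ab]]]; last first.
  rewrite /covers (ltnNge b) le_ab (ltnNge b) (leq_trans (leq_pred a)) //=.
  by rewrite (cnt_pred de a a_gt0); case: (de a) => //; rewrite addn0 => ->.
have /andP [a_gt0 lt_an] := de_lt a de_a.
have ca := cnt_pred de a a_gt0; rewrite de_a in ca.
have ex_b : exists b, cnt de a.-1 < cnt al b.
  by exists n; rewrite total; have := leq_cnt de a n (ltnW lt_an); lia.
case: (ex_minnP ex_b) => b lt_b min_b; exists b.
have b_gt0 : 0 < b by case: b lt_b {min_b}.
have lt_ab : a <= b.
  rewrite leqNgt; apply/negP => lt_ba; have := valid a.-1.
  by have := leq_cnt al b a.-1 (ltac:(lia)); lia.
have cb : cnt al b.-1 <= cnt de a.-1.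
  by rewrite leqNgt; apply/negP => /min_b; lia.
have := cnt_pred al b b_gt0; rewrite /covers.
by case: (al b) => /= e; split=> //; lia.
Qed.

Lemma al_covers n al de b : is_code n al de ->
  al b <-> exists a, [/\ a <= b, covers al de a b & ~~ covers al de a b.+1].
Proof.
move=> [al_lt _ valid _]; split=> [al_b|[a [le_ab]]]; last first.
  rewrite /covers (ltnNge b) le_ab (ltnNge b.+1) (leq_trans le_ab) //=.
  case: b {le_ab} => [|b] /=; first by move->.
  by rewrite cntS; case: (al b.+1) => //; rewrite addn0 => ->.
have /andP [b_gt0 lt_bn] := al_lt b al_b.
have cb := cnt_pred al b b_gt0; rewrite al_b in cb.
have ex_a : exists a, cnt al b <= cnt de a by exists b.
case: (ex_minnP ex_a) => a le_a min_a; exists a.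
have le_ab : a <= b by apply: min_a.
have a_gt0 : 0 < a by case: a le_a {min_a le_ab} => //; rewrite cb addn1.
have ca : cnt de a.-1 < cnt al b.
  by rewrite ltnNge; apply/negP => /min_a; lia.
have := cnt_pred de a a_gt0; rewrite /covers.
by case: (de a) => /= e; split=> //; lia.
Qed.

Lemma covers_inj n al de al' de' : is_code n al de -> is_code n al' de' ->
  covers al de =2 covers al' de' -> al =1 al' /\ de =1 de'.
Proof.
move=> cd cd' eqJ; split=> j; apply/idP/idP.
- move/(al_covers _ _ _ _ cd) => [a]; rewrite !eqJ => ?.
  by apply/(al_covers _ _ _ _ cd'); exists a.
- move/(al_covers _ _ _ _ cd') => [a]; rewrite -!eqJ => ?.
  by apply/(al_covers _ _ _ _ cd); exists a.
- move/(de_covers _ _ _ _ cd) => [b]; rewrite !eqJ => ?.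
  by apply/(de_covers _ _ _ _ cd'); exists b.
- move/(de_covers _ _ _ _ cd') => [b]; rewrite -!eqJ => ?.
  by apply/(de_covers _ _ _ _ cd); exists b.
Qed.

(** * Turns of a word and its partial-sum code *)

(** One bit for each [b]-step, in order: whether the next step is not a [b]-step.
The end of the word counts as a turn; this makes [turns] additive over the
components of a Dyck path, and its last bit is always true. *)
Fixpoint turns (b : bool) (s : seq bool) : seq bool :=
  if s is x :: s' then
    if x == b then (head (~~ b) s' != b) :: turns b s' else turns b s'
  else [::].

(** The positions of the true bits, counted from 1. *)
Definition true_labels (l : seq bool) : seq nat := mask l (iota 1 (size l)).

Lemma true_labels_cons c l : true_labels (c :: l) = nseq c 1 ++ map S (true_labels l).
Proof. by rewrite /true_labels /= -[2]/(1 + 1) iotaDl map_mask; case: c. Qed.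

Lemma mem_true_labels l j : (j \in true_labels l) = (0 < j) && nth false l j.-1.
Proof.
elim: l j => [|c l IHl] j; first by rewrite nth_nil andbF.
rewrite true_labels_cons mem_cat; case: j => [|j].
  by rewrite mem_nseq andbF; apply/mapP => -[].
rewrite (mem_map succn_inj) IHl mem_nseq /=.
by case: j => [|j] /=; case: c.
Qed.

Lemma size_turns b s : size (turns b s) = count_mem b s.
Proof. by elim: s => //= x s IHs; case: eqP => _ /=; rewrite IHs. Qed.

Lemma last_turns b s : last true (turns b s).
Proof.
suff H c : c || (turns b s != [::]) -> last c (turns b s) by exact: H true isT.
elim: s c => [|x s IHs] c /=; first by rewrite orbF.
case: (x =P b) => _ /=; last exact: IHs.
move=> _; apply: IHs; case: s => [|y s] /=; first by case: b.
by case: (y == b); rewrite ?orbT.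
Qed.

Lemma double_labels_turns b s : double_labels b s = true_labels (map negb (turns b s)).
Proof.
elim: s => [|x [|y s] IHs] //.
  by clear IHs; case: x; case: b.
transitivity (nseq ((x == b) && (y == b)) 1 ++
   map (addn (x == b)) (double_labels b (y :: s))).
  rewrite /double_labels /= -[1]/(1 + 0) iotaDl filter_map -map_comp.
  by case ex: (x == b); case ey: (y == b) => /=; [congr (_ :: _)|..];
    rewrite -map_comp; apply: eq_map => i /=; rewrite ?ex ?ey ?add0n.
rewrite IHs /=; case: (x == b) => /=; last by rewrite map_id_in.
by rewrite negbK true_labels_cons.
Qed.

Definition run_lengths (b : bool) (s : seq bool) : seq nat :=
  [seq x.2 | x <- runs s & x.1 == b].

Definition all_psums (l : seq nat) : seq nat := partial_sums (size l) l.

Lemma all_psums_cons a l : all_psums (a :: l) = a :: map (addn a) (all_psums l).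
Proof.
rewrite /all_psums /partial_sums /= take0 /= addn0; congr (_ :: _).
by rewrite -[2]/(1 + 1) iotaDl -!map_comp.
Qed.

Lemma all_psums_take r l : r <= size l -> partial_sums r l = take r (all_psums l).
Proof.
by move=> le_r; rewrite /all_psums /partial_sums -map_take take_iota (minn_idPl le_r).
Qed.

Lemma runs_cons x s :
  runs (x :: s) =
    if runs s is (c, m) :: t then
      if x == c then (c, m.+1) :: t else [:: (x, 1), (c, m) & t]
    else [:: (x, 1)].
Proof. by []. Qed.

Lemma runs_head x s : exists m t, runs (x :: s) = (x, m) :: t.
Proof.
rewrite runs_cons; case: (runs s) => [|[c m] t]; first by exists 1, [::].
by case: eqP => [->|_]; [exists m.+1, t | exists 1, ((c, m) :: t)].
Qed.

(** The partial sums of the run lengths are the labels of the last steps of the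
runs. *)
Lemma all_psums_run_lengths b s : all_psums (run_lengths b s) = true_labels (turns b s).
Proof.
elim: s => [|x [|y s] IHs] //; first by clear IHs; case: x; case: b.
have [m [t er]] := runs_head y s; rewrite /run_lengths er in IHs.
rewrite /run_lengths runs_cons er.
have -> : turns b [:: x, y & s] =
  if x == b then (y != b) :: turns b (y :: s) else turns b (y :: s) by [].
case: (x =P y) => [->|neq_xy].
  rewrite /= in IHs *; case: eqP IHs => // _ IHs.
  by rewrite true_labels_cons -IHs !all_psums_cons /= -map_comp.
case: (x =P b) => [exb|neq_xb]; last first.
  by rewrite [filter _ _]/=; case: eqP.
have nyb : y == b = false by apply/eqP => e; apply: neq_xy; rewrite exb.
by rewrite true_labels_cons -IHs /= exb nyb eqxx /= all_psums_cons.
Qed.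

(** A final upstep is a turn without being a peak, hence the hypothesis. *)
Lemma npeaksE s : ~~ last true s -> npeaks s = count id (turns true s).
Proof.
have npS x s' : npeaks (x :: s') = (x && ~~ head true s') + npeaks s'.
  by rewrite /npeaks /= -[1]/(1 + 0) iotaDl count_map nth0.
elim: s => // x [|y s] IHs; first by case: x.
by move=> /IHs {}IHs; rewrite npS IHs {IHs}; case: x; case: y.
Qed.

Lemma is_dyckP s :
  reflect (count_mem true s = count_mem false s /\
           forall i, count_mem false (take i s) <= count_mem true (take i s))
          (is_dyck s).
Proof.
apply: (iffP andP) => -[/eqP e H]; split; rewrite ?e //.
  move=> i; case: (ltnP i (size s).+1) => [lt_i|/ltnW le_i].
    exact: (forallP H (Ordinal lt_i)).
  by rewrite take_oversize // e.
by apply/forallP => i; apply: H.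
Qed.

(** Inside a word, turns from up to down and from down to up alternate, so their
numbers before a given step depend only on the first step and on that step. *)
Lemma turns_balance (s1 : seq bool) y s2 :
  count id (take (count_mem true s1) (turns true (s1 ++ y :: s2))) +
    ~~ head y s1 =
  count id (take (count_mem false s1) (turns false (s1 ++ y :: s2))) + ~~ y.
Proof.
elim: s1 => [|x s1 IHs] /=; first by rewrite !take0.
have hd b : head b (s1 ++ y :: s2) = head y s1 by case: (s1).
by case: x; rewrite /= ?add0n ?add1n /= !hd; move: IHs; case: (head _ _) => /=; lia.
Qed.

Lemma count_mem_split (b : bool) s m : m < count_mem b s ->
  exists s1 s2, s = s1 ++ b :: s2 /\ count_mem b s1 = m.
Proof.
elim: s m => // x s IHs m /=; case: (x =P b) => [->|neq_xb] /=.
  case: m => [|m] lt_m; first by exists [::], s.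
  by have [s1 [s2 [-> e]]] := IHs m lt_m; exists (b :: s1), s2; rewrite /= eqxx e.
rewrite add0n => /IHs [s1 [s2 [-> e]]]; exists (x :: s1), s2.
by rewrite /= (introF eqP neq_xb) e.
Qed.

Lemma turns_inj s t : size s = size t -> head true s = head true t ->
  (forall b, turns b s = turns b t) -> s = t.
Proof.
elim: s t => [|x s IHs] [|x' t] //= [esz] ehd; subst x'.
move=> eqT; congr (_ :: _).
have ehd : head true s = head true t.
  have := eqT x; rewrite /= eqxx => -[+ _].
  by case: (x) (s) (t) esz => - [|[] ?] [|[] ?].
apply: IHs => // b; have := eqT b; case: (x == b) => // -[] //.
Qed.

Lemma count_id_gt0 l : last true l -> l != [::] -> 0 < count id l.
Proof.
case/lastP: l => // l x; rewrite last_rcons => -> _.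
by rewrite -cats1 count_cat /= addn1.
Qed.

(** The word of length [N] that starts with [b] and turns as prescribed: the
bit of the current step determines the next step. *)
Fixpoint unturn (N : nat) (b : bool) (tu td : seq bool) : seq bool :=
  if N is N'.+1 then
    let b' := b (+) head false (if b then tu else td) in
    b :: (if b then unturn N' b' (behead tu) td else unturn N' b' tu (behead td))
  else [::].

(** The balance between the numbers of true bits ensures that no list is
exhausted before the other: a list that is needed still contains its last bit,
which is true. *)
Lemma unturnP N b tu td : N = size tu + size td ->
    last true tu -> last true td -> td != [::] ->
    count id tu + ~~ b = count id td ->
  let s := unturn N b tu td in
  [/\ turns true s = tu, turns false s = td & head true s = b].
Proof.
elim: N => [|N IHN] in b tu td *; first by case: td => [|c td]; rewrite /= ?addnS.
move=> eN Lu Ld td0 ec /=.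
have hdN N' b' u d c : N' != 0 -> head c (unturn N' b' u d) = b' by case: N'.
case: b => /= in ec *.
  case: tu => [|c tu] /= in eN Lu ec *.
    by have := count_id_gt0 _ Ld td0; lia.
  have N0 : N != 0 by case: td td0 eN {Ld ec} => //= *; lia.
  have Lu' : last true tu by case: (tu) Lu => //; case: c.
  have tu0 : c || (tu != [::]) by case: (c) Lu; case: (tu).
  rewrite !hdN //.
  have [] := IHN (~~ c) tu td => //; first by lia.
    by move: ec; case: (c) => /=; lia.
  by move=> -> -> _; case: (c).
case: td => [|c td] //= in eN Ld td0 ec *.
have Ld' : last true td by case: (td) Ld => //; case: (c).
have [td0'|td0'] := eqVneq td [::].
  subst td; have c1 : c by [].
  have tu0 : tu = [::].
    apply/eqP; apply: contraT => /(count_id_gt0 _ Lu).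
    by move: ec; rewrite c1 /=; lia.
  by subst tu; case: N eN {IHN hdN}; rewrite c1.
have N0 : N != 0 by case: td td0' eN {Ld Ld' ec} => //= *; lia.
rewrite !hdN //.
have [] := IHN c tu td => //; first by lia.
  by move: ec; case: (c) => /=; lia.
by move=> -> -> _; case: (c).
Qed.

(** * Codes of Dyck paths *)

(** Membership of [j] in the half A (for [b] = true) or D of the code.  The last
[b]-step is left out, as its turn carries no information. *)
Definition step_turn (b : bool) (s : seq bool) (j : nat) : bool :=
  (0 < j < count_mem b s) && nth false (turns b s) j.-1.

Lemma step_turn_lt b s j : step_turn b s j -> 0 < j < count_mem b s.
Proof. by case/andP. Qed.

Lemma cnt_step_turn b s m : m < count_mem b s ->
  cnt (step_turn b s) m = count id (take m (turns b s)).
Proof.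
elim: m => [|m IHm] lt_m; first by rewrite take0.
rewrite cntS IHm; last lia.
rewrite (take_nth false) ?size_turns; last lia.
by rewrite -cats1 count_cat /= /step_turn lt_m addn0.
Qed.

Lemma dyck_head s : is_dyck s -> head true s.
Proof. by case/is_dyckP=> _ /(_ 1); case: s => [|[] s] //=; rewrite take0. Qed.

Lemma dyck_rcons s : is_dyck s -> s != [::] -> exists s', s = rcons s' false.
Proof.
case/lastP: s => // s x /is_dyckP [e /(_ (size s))] + _.
move: e; rewrite -cats1 take_size_cat // !count_cat.
by case: x => /=; [lia | exists s; rewrite cats1].
Qed.

(** The prefix that ends with the upstep of label [m + 1] contains as many peaks
as valleys, and at most [m] downsteps. *)
Lemma dyck_step_turns s : is_dyck s ->
  is_code (count_mem true s) (step_turn true s) (step_turn false s).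
Proof.
move=> ds; have /is_dyckP [e pre] := ds; set n := count_mem true s in e *.
have lt_al := @step_turn_lt true s; have lt_de := @step_turn_lt false s.
rewrite -/n -?e in lt_al lt_de.
have valid m : m < n -> cnt (step_turn true s) m <= cnt (step_turn false s) m.
  move=> lt_mn; have [s1 [s2 [es em]]] := count_mem_split true s m lt_mn.
  have := turns_balance s1 true s2; rewrite -es em addn0.
  have -> : head true s1 by move: (dyck_head s ds); rewrite es; case: (s1).
  rewrite addn0 -!cnt_step_turn //; first by rewrite -/n; move=> ->; apply: leq_cnt;
    have := pre (size s1); rewrite es take_size_cat // em.
  by have := pre (size s1); rewrite es take_size_cat // em -es -e; lia.
have total : cnt (step_turn true s) n.-1 = cnt (step_turn false s) n.-1.
  case: (posnP n) => [->|n_gt0] //.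
  have [s' es] : exists s', s = rcons s' false.
    by apply: dyck_rcons => //; apply: contraTneq n_gt0; rewrite /n => ->.
  have := turns_balance s' false [::]; rewrite cats1 -es.
  have -> : head false s'.
    move: (dyck_head s ds) e n_gt0; rewrite /n es; case: (s') => [|x ?] //=.
  rewrite addn0.
  have nt : count_mem true s' = n by rewrite /n es -cats1 count_cat /= !addn0.
  have nf : count_mem false s' = n.-1.
    by move: e; rewrite es -cats1 count_cat /=; lia.
  rewrite nt nf cnt_step_turn; last by rewrite -/n; lia.
  rewrite cnt_step_turn; last by rewrite -e; lia.
  rewrite take_oversize ?size_turns //.
  have := last_turns true s; have := size_turns true s; rewrite -/n.
  case/lastP: (turns true s) => [|l x]; first by move=> /= n0; lia.
  rewrite size_rcons last_rcons => <- ->.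
  by rewrite -cats1 take_size_cat // count_cat /= addn0 => /addIn.
split=> // [m|].
  case: (ltnP m n) => [/valid //|le_nm].
  by rewrite !(cnt_support n) ?total //; lia.
by rewrite !(cnt_support n _ n) ?total //; lia.
Qed.

(** The word with the prescribed turns cannot go below ground level: at the first
such step, alternation of turns would give one more letter to A than to D. *)
Lemma realize n al de : is_code n al de -> 0 < n ->
  exists q, [/\ is_dyck q, size q = n.*2, count_mem true q = n,
    step_turn true q =1 al & step_turn false q =1 de].
Proof.
move=> [al_lt de_lt valid total] n_gt0.
pose l (f : nat -> bool) := [seq f i | i <- iota 1 n.-1].
have szl f : size (l f) = n.-1 by rewrite size_map size_iota.
have cntl f m : m < n -> count id (take m (l f)) = cnt f m.
  move=> lt_mn; rewrite -map_take take_iota (minn_idPl _) ?count_map //; lia.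
have cntl' f : count id (l f) = cnt f n.-1.
  by rewrite -(cntl f) ?take_oversize ?szl //; lia.
set N := size (rcons (l al) true) + size (rcons (l de) true).
have eN : N = n.*2 by rewrite /N !size_rcons !szl; lia.
have [] := unturnP N true (rcons (l al) true) (rcons (l de) true) erefl.
- by rewrite last_rcons.
- by rewrite last_rcons.
- by case: (l de).
- rewrite -!cats1 !count_cat !cntl' /= addn0.
  by move: total; rewrite !(cnt_support n _ n) ?leq_pred // => ->.
set q := unturn _ _ _ _ => tu td hq.
have ct : count_mem true q = n by rewrite -size_turns tu size_rcons szl prednK.
have cf : count_mem false q = n by rewrite -size_turns td size_rcons szl prednK.
have szq : size q = n.*2.
  rewrite -(count_predC (pred1 true) q) ct.
  by rewrite (eq_count (a2 := pred1 false)) ?cf ?addnn // => -[].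
have bits b f : turns b q = rcons (l f) true -> count_mem b q = n ->
    (forall j, f j -> 0 < j < n) -> step_turn b q =1 f.
  move=> eb cb f_lt j; rewrite /step_turn cb eb nth_rcons szl.
  case: (boolP (0 < j < n)) => [lt_j|nlt_j]; last first.
    by apply/esym; apply: contraNF nlt_j => /f_lt.
  by rewrite ifT ?(nth_map 0) ?size_iota ?nth_iota ?add1n ?prednK //; lia.
exists q; split=> //; try exact: bits.
apply/is_dyckP; split=> [|i]; first by rewrite ct cf.
elim: i => [|i IHi]; first by rewrite take0.
case: (ltnP i (size q)) => [lt_i|le_i]; last by rewrite !take_oversize ?ct ?cf // ltnW.
rewrite (take_nth false) // -cats1 !count_cat; move: IHi => /=.
case ei: (nth false q i) => /= IHi; first by lia.
rewrite leqNgt; apply/negP => lt_c.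
have {lt_c IHi} ecnt : count_mem false (take i q) = count_mem true (take i q).
  by move: lt_c IHi => /=; lia.
have eq : q = take i q ++ false :: drop i.+1 q.
  by rewrite -{1}(cat_take_drop i q) (drop_nth false) // ei.
have hd : head false (take i q).
  by move: hq; rewrite {1}eq; case: (take i q) => [|[] ?].
have := turns_balance (take i q) false (drop i.+1 q); rewrite -eq hd /= addn0.
have lt_m : count_mem true (take i q) < n.
  by rewrite -ecnt -cf [in X in _ < X]eq count_cat /=; lia.
rewrite ecnt -(cnt_step_turn true) ?ct // -(cnt_step_turn false) ?cf //.
have -> : cnt (step_turn true q) (count_mem true (take i q)) =
    cnt al (count_mem true (take i q)).
  by apply: eq_cnt => j _; apply: bits.
have -> : cnt (step_turn false q) (count_mem true (take i q)) =
    cnt de (count_mem true (take i q)).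
  by apply: eq_cnt => j _; apply: bits.
by have := valid (count_mem true (take i q)); lia.
Qed.

(** * The involution L on codes *)

Lemma dyck_turns_rcons b s : is_dyck s -> s != [::] ->
  exists l, turns b s = rcons l true /\ size l = (count_mem true s).-1.
Proof.
move=> ds s0; have [e _] := is_dyckP s ds.
have szT : size (turns b s) = count_mem true s by rewrite size_turns; case: b.
have s_gt0 : 0 < count_mem true s.
  by move: (dyck_head s ds) s0; case: (s) => [|[] ?].
have := last_turns b s; case/lastP: (turns b s) szT => [e0|l x].
  by rewrite -e0 in s_gt0.
by rewrite size_rcons last_rcons => <- ->; exists l.
Qed.

Lemma true_labels_rcons l c : true_labels (rcons l c) = true_labels l ++ nseq c (size l).+1.
Proof.
by rewrite /true_labels -cats1 size_cat iotaD mask_cat ?size_iota //= add1n; case: c.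
Qed.

Lemma size_true_labels l : size (true_labels l) = count id l.
Proof. by rewrite /true_labels size_mask ?size_iota. Qed.

Lemma true_labels_sorted l : sorted ltn (true_labels l).
Proof. by apply: sorted_mask (iota_ltn_sorted _ _); apply: ltn_trans. Qed.

(** The code as defined through run lengths lists the sets [step_turn]. *)
Lemma code_dyck s : is_dyck s -> s != [::] ->
  [/\ sorted ltn (code s).1, sorted ltn (code s).2,
      (code s).1 =i [pred j | step_turn true s j]
    & (code s).2 =i [pred j | step_turn false s j]].
Proof.
move=> ds s0; have [e _] := is_dyckP s ds.
have [lu [eu szu]] := dyck_turns_rcons true s ds s0.
have [ld [ed szd]] := dyck_turns_rcons false s ds s0.
set n := count_mem true s in e szu szd.
have n_gt0 : 0 < n by rewrite /n -size_turns eu size_rcons.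
have er : (npeaks s).-1 = count id lu.
  rewrite npeaksE ?eu; first by rewrite -cats1 count_cat /= addn1.
  by have [s' ->] := dyck_rcons s ds s0; rewrite last_rcons.
have eud : count id lu = count id ld.
  have [_ _ _] := dyck_step_turns s ds; rewrite -/n.
  rewrite !(cnt_support n _ n) ?leq_pred //; try by [move=> j /step_turn_lt; rewrite -?e].
  rewrite !cnt_step_turn -?e -/n ?prednK // eu ed.
  by rewrite -!cats1 !take_size_cat.
have eA : ascents s = run_lengths true s.
  by rewrite /ascents /run_lengths; congr map; apply: eq_filter => -[[] m].
have eD : descents s = run_lengths false s.
  by rewrite /descents /run_lengths; congr map; apply: eq_filter => -[[] m].
have take_pos b l : turns b s = rcons l true -> count id l = (npeaks s).-1 ->
    size l = n.-1 ->
    sorted ltn (partial_sums (npeaks s).-1 (run_lengths b s)) /\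
    partial_sums (npeaks s).-1 (run_lengths b s) =i [pred j | step_turn b s j].
  move=> eb ec sz.
  have epos := all_psums_run_lengths b s; rewrite eb true_labels_rcons in epos.
  have szr : size (run_lengths b s) = (npeaks s).-1.+1.
    have <- : size (all_psums (run_lengths b s)) = size (run_lengths b s).
      by rewrite /all_psums /partial_sums size_map size_iota.
    by rewrite epos size_cat size_true_labels ec addn1.
  rewrite all_psums_take ?szr // epos take_size_cat ?size_true_labels //.
  split=> [|j]; first exact: true_labels_sorted.
  rewrite mem_true_labels inE /step_turn eb nth_rcons sz.
  have -> : count_mem b s = n by case: (b).
  case: (ltnP j.-1 n.-1) => lt_j; first by rewrite (_ : j < n = true) ?andbT //; lia.
  rewrite nth_default ?sz // andbF; apply/esym/negbTE.
  by case: (posnP j) => //= ?; rewrite (_ : j < n = false) //; lia.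
have [su mu] := take_pos true lu eu (esym er) szu.
have [sd md] := take_pos false ld ed (etrans (esym eud) (esym er)) szd.
by rewrite /code eA eD; split.
Qed.

Lemma KL_code_dyck s : is_dyck s ->
  [/\ sorted ltn (KL_code s).1, sorted ltn (KL_code s).2,
      (KL_code s).1 =i [pred j | (0 < j < count_mem true s) && ~~ step_turn false s j]
    & (KL_code s).2 =i [pred j | (0 < j < count_mem true s) && ~~ step_turn true s j]].
Proof.
move=> ds; rewrite /KL_code /= !double_labels_turns.
suff H b : true_labels (map negb (turns b s)) =i
    [pred j | (0 < j < count_mem true s) && ~~ step_turn b s j].
  by split; rewrite ?true_labels_sorted //; apply: H.
move=> j; rewrite mem_true_labels inE /step_turn.
have [e _] := is_dyckP s ds.
have -> : count_mem b s = count_mem true s by case: b.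
have [->|s0] := eqVneq s [::]; first by rewrite /= nth_nil ltn0 !andbF.
have [l [-> szl]] := dyck_turns_rcons b s ds s0.
rewrite map_rcons !nth_rcons size_map.
case: j => [|j] //=.
have -> : j.+1 < count_mem true s = (j < size l).
  have : 0 < count_mem true s by move: (dyck_head s ds) s0; case: (s) => [|[] ?].
  by rewrite szl; lia.
case: ltngtP => [lt_j|//|//] /=.
by rewrite (nth_map false).
Qed.

(** In terms of sets, L exchanges A and D and takes complements.  The complement
of a code is a code, so that a path with the required code exists. *)
Lemma KLP s : is_dyck s ->
  [/\ is_dyck (KL s), size (KL s) = size s,
      forall j, step_turn true (KL s) j =
        (0 < j < count_mem true s) && ~~ step_turn false s j
    & forall j, step_turn false (KL s) j =
        (0 < j < count_mem true s) && ~~ step_turn true s j].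
Proof.
move=> ds; have [es|s0] := eqVneq s [::].
  subst s; rewrite /KL; case: pickP => [q _|_]; last by split=> // -[].
  by rewrite (tuple0 q); split=> // -[].
have [e _] := is_dyckP s ds.
set n := count_mem true s in e *.
have n_gt0 : 0 < n by rewrite /n; move: (dyck_head s ds) s0; case: (s) => [|[] ?].
have [su sd mu md] := KL_code_dyck s ds.
have ne0 (q : seq bool) : size q = size s -> q != [::] by case: q => //=; case: (s) s0.
have szs : size s = n.*2.
  rewrite -(count_predC (pred1 true) s).
  by rewrite (eq_count (a1 := predC _) (a2 := pred1 false)) -?e ?addnn // => -[].
rewrite /KL; case: pickP => [q /andP [dq /eqP eq]|].
  have [_ _ qu qd] := code_dyck q dq (ne0 q (size_tuple q)).
  split=> // [|j|j]; first exact: size_tuple.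
    by have := mu j; rewrite -eq qu !inE.
  by have := md j; rewrite -eq qd !inE.
have := is_code_compl n _ _ (dyck_step_turns s ds).
case/realize => // q [dq szq cq qu qd].
have szq' : size q == size s by rewrite szq szs.
move/(_ (Tuple szq')) => /=; rewrite dq /= => /eqP; case.
have [su' sd' mu' md'] := code_dyck q dq (ne0 q (eqP szq')).
rewrite [code q]surjective_pairing [KL_code s]surjective_pairing; congr pair;
  apply: (irr_sorted_eq ltn_trans ltnn) => // j.
  by rewrite mu' mu !inE qu.
by rewrite md' md !inE qd.
Qed.

(** A word that ends below the level [- h] has a first step to the level
[- h - 1]. *)
Lemma first_return (s : seq bool) h : count_mem true s + h < count_mem false s ->
  exists p t, [/\ s = p ++ false :: t, count_mem false p = count_mem true p + h &
    forall i, count_mem false (take i p) <= count_mem true (take i p) + h].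
Proof.
elim: s h => // -[] s IHs h lt_c.
  have [|p [t [-> e pre]]] := IHs h.+1; first by move: lt_c => /=; lia.
  exists (true :: p), t; split=> [//||[|i] //]; first by move: e => /=; lia.
  by have := pre i => /=; lia.
case: h lt_c => [|h] lt_c; first by exists [::], s.
have [|p [t [-> e pre]]] := IHs h; first by move: lt_c => /=; lia.
exists (false :: p), t; split=> [//||[|i] //]; first by move: e => /=; lia.
by have := pre i => /=; lia.
Qed.

Lemma dyck_first_component s : is_dyck s -> s != [::] ->
  exists p t, [/\ s = elevate p ++ t, is_dyck p & is_dyck t].
Proof.
case/is_dyckP; case: s => [|[] s] // e pre _; last first.
  by have := pre 1; rewrite /= take0.
have [|p [t [es ep prep]]] := first_return s 0; first by move: e => /=; lia.
exists p, t; rewrite /elevate cat_cons cat_rcons -es; split=> //; apply/is_dyckP; split.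
- by rewrite ep addn0.
- by move=> i; have := prep i; rewrite addn0.
- by move: e ep; rewrite es /= !count_cat /=; lia.
- move=> i; have := pre (size p + i).+2.
  have -> : take (size p + i).+2 (true :: s) = true :: p ++ false :: take i t.
    rewrite es /= take_cat ltnNge leqW ?leq_addr //=.
    by have -> : (size p + i).+1 - size p = i.+1 by lia.
  by move: ep; rewrite /= !count_cat /=; lia.
Qed.

Lemma dyck_components s : is_dyck s ->
  exists2 ps, all is_dyck ps & s = flatten [seq elevate p | p <- ps].
Proof.
have [N] := ubnP (size s); elim: N s => // N IHN s lt_s ds.
have [->|s0] := eqVneq s [::]; first by exists [::].
have [p [t [es dp dt]]] := dyck_first_component s ds s0.
have [|ps dps et] := IHN t _ dt.
  by move: lt_s; rewrite es size_cat /elevate /= size_rcons; lia.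
by exists (p :: ps); rewrite /= ?dp // -et.
Qed.

Lemma dyck_elevate_cat p t : is_dyck p -> is_dyck t -> is_dyck (elevate p ++ t).
Proof.
move=> /is_dyckP [ep prep] /is_dyckP [et pret]; apply/is_dyckP.
rewrite /elevate cat_cons cat_rcons; split=> [|i].
  by move: ep et; rewrite /= !count_cat /=; lia.
case: i => [|i] //=; rewrite take_cat; case: ltnP => [_|le_i].
  by have := prep i => /=; lia.
rewrite !count_cat; case: (i - size p) => [|r] /=; first by move: ep => /=; lia.
by have := pret r; move: ep => /=; lia.
Qed.

(** * The derivative on codes *)

(** The junction of two components is itself a turn, and the end of a word counts
as one, so no bit changes under concatenation. *)
Lemma turns_cat b s x t : head (~~ x) t = ~~ x ->
  turns b (rcons s x ++ t) = turns b (rcons s x) ++ turns b t.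
Proof.
move=> ht; elim: s => [|y s IHs] /=.
  case: (x =P b) => [exb|] //=.
  by rewrite -exb ht.
have -> c : head c (rcons s x ++ t) = head c (rcons s x) by case: (s).
by rewrite IHs; case: (y == b).
Qed.

Lemma turns_rcons_neq b s : turns b (rcons s (~~ b)) = turns b s.
Proof.
elim: s => [|x s IHs] /=; first by case: b.
by rewrite IHs; case: s {IHs} => [|y s] //=.
Qed.

(** Repeating the last step turns the last bit to false and adds a true one. *)
Lemma turns_rcons_eq b s : exists l,
  turns b (rcons s b) = rcons l true /\
  turns b (rcons (rcons s b) b) = rcons (rcons l false) true.
Proof.
elim: s => [|x s [l [e1 e2]]]; first by exists [::]; case: b.
exists (if x == b then (head (~~ b) (rcons s b) != b) :: l else l).
rewrite !rcons_cons /= e1 e2; case: (x == b) => //.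
by have -> : head (~~ b) (rcons (rcons s b) b) = head (~~ b) (rcons s b) by case: (s).
Qed.

Lemma count_elevate b p : count_mem b (elevate p) = (count_mem b p).+1.
Proof. by rewrite /elevate /= -cats1 count_cat /=; case: b => /=; lia. Qed.

(** The first step of the component moves the labels of the upsteps of [p] by one,
whereas those of its downsteps are kept: the shift [j - b] is by [b] seen as a
number.  The last letter [m] of the component is in both halves of the code as
soon as another component follows. *)
Lemma step_turn_component b p t m j : is_dyck p -> is_dyck t ->
    m = (count_mem true p).+1 ->
  step_turn b (elevate p ++ t) j =
    if j < m then step_turn b p (j - b)
    else if j == m then t != [::] else step_turn b t (j - m).
Proof.
move=> dp dt em; have [ep _] := is_dyckP p dp.
have cp c : count_mem c (elevate p) = m.
  by rewrite count_elevate em; case: c => //; rewrite ep.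
have eT : turns b (elevate p ++ t) = turns b (elevate p) ++ turns b t.
  by rewrite /elevate -rcons_cons turns_cat //; exact: dyck_head dt.
have szE : size (turns b (elevate p)) = m by rewrite size_turns cp.
have t0 : t != [::] -> 0 < count_mem b t.
  have -> : count_mem b t = count_mem true t.
    by case: (is_dyckP t dt) b {eT szE} => e _ [].
  by move: (dyck_head t dt); case: (t) => [|[] ?].
have cpb : count_mem b p = m.-1 by rewrite em; case: b {eT szE t0} => //=; rewrite -ep.
rewrite /step_turn count_cat cp eT nth_cat szE cpb.
case: (ltngtP j m) => [lt_jm|lt_mj|->]; last first.
- rewrite (_ : m.-1 < m = true); last lia.
  have [->|/t0 lt0] := eqVneq t [::]; first by rewrite /= addn0 ltnn andbF.
  rewrite (_ : 0 < m < _ = true); last lia.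
  have := last_turns b (elevate p); case/lastP: (turns b _) szE => [|l x].
    by rewrite em.
  by rewrite size_rcons last_rcons nth_rcons => <- ->; rewrite /= ltnn eqxx.
- rewrite (_ : j.-1 < m = false); last lia.
  rewrite (_ : j.-1 - m = (j - m).-1); last lia.
  by rewrite (_ : (0 < j < m + count_mem b t) = (0 < j - m < count_mem b t)) //; lia.
rewrite (_ : j.-1 < m = true); last lia.
rewrite (_ : j < m + count_mem b t = true) ?andbT; last lia.
case: b {eT szE t0} cpb => cpb.
  rewrite /elevate -rcons_cons (turns_rcons_neq true) subn1.
  have hd : p != [::] -> head false p = true.
    by move: (dyck_head p dp); case: (p) => [|[] ?].
  case: j lt_jm => [|[|j]] lt_jm //=; last by rewrite (_ : j.+1 < m.-1 = true) //; lia.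
  by rewrite hd //; apply: contraTneq lt_jm => p0; rewrite em p0.
rewrite subn0; have [p0|p0] := eqVneq p [::].
  by move: lt_jm em; rewrite p0; case: j => //= j; lia.
have [p' ep'] := dyck_rcons p dp p0.
have [l [e1 e2]] := turns_rcons_eq false p'.
rewrite -ep' in e1 e2.
have szl : size l = m.-2.
  by have := size_turns false p; rewrite e1 size_rcons cpb; lia.
have -> : turns false (elevate p) = rcons (rcons l false) true by rewrite -e2.
rewrite e1 !nth_rcons size_rcons szl.
case: (posnP j) => [->|j_gt0] //=.
rewrite (_ : j.-1 < m.-2.+1 = true); last lia.
case: (ltngtP j.-1 m.-2) => [lt_j|?|?]; last 2 first.
- by lia.
- by rewrite (_ : j < m.-1 = false) //; lia.
by rewrite (_ : j < m.-1 = true) //; lia.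
Qed.

(** For a Dyck path and [0 < j < n], this means that the path is at ground level
after [j] upsteps and [j] downsteps. *)
Definition is_return (s : seq bool) (j : nat) : bool :=
  cnt (step_turn false s) j.-1 < cnt (step_turn true s) j.

(** By induction on the components: on a component u P d the operation L acts
through [KLP] on P, whose labels are shifted as in [step_turn_component], and
the letters that separate components are returns. *)
Lemma derivative_KLP s : is_dyck s -> let n := count_mem true s in
  [/\ is_dyck (derivative KL s), count_mem true (derivative KL s) = n,
      forall j, 0 < j < n -> step_turn true (derivative KL s) j =
        (1 < j) && ~~ step_turn false s j.-1 || is_return s j
    & forall j, 0 < j < n -> step_turn false (derivative KL s) j =
        (j < n.-1) && ~~ step_turn true s j.+1 || is_return s j].
Proof.
move=> ds n; rewrite {}/n; have [ps dps es] := dyck_components s ds.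
have es' : derivative KL s = flatten [seq elevate (KL p) | p <- ps].
  by rewrite es derivativeE.
move: (derivative KL s) es' => s' es' {ds}.
elim: ps s s' dps es es' => [|p ps IHps] s s'.
  by move=> _ -> ->; split=> // [|j|j]; rewrite ?ltn0 ?andbF //; apply/is_dyckP; split.
move=> /andP [dp dps] es es'.
set t := flatten [seq elevate q | q <- ps].
set t' := flatten [seq elevate (KL q) | q <- ps].
have {}es : s = elevate p ++ t by [].
have {}es' : s' = elevate (KL p) ++ t' by [].
have [dt' ct' tu' td'] := IHps t t' dps erefl erefl.
have dt : is_dyck t.
  by rewrite /t; elim: (ps) dps => [_|q qs IHq /= /andP [dq /IHq]]; 
    [apply/is_dyckP; split | exact: dyck_elevate_cat].
have [dp' szp' pu' pd'] := KLP p dp.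
have [ep _] := is_dyckP p dp; have [ep' _] := is_dyckP _ dp'.
set n1 := count_mem true p in ep pu' pd'.
have cp' : count_mem true (KL p) = n1.
  have sz (q : seq bool) : size q = count_mem true q + count_mem false q.
    by rewrite -(count_predC (pred1 true) q); congr (_ + _); apply: eq_count => -[].
  by have := szp'; rewrite !sz -ep' -ep -/n1; lia.
have cs : count_mem true s = n1.+1 + count_mem true t by rewrite es count_cat count_elevate.
have cs' : count_mem true s' = n1.+1 + count_mem true t.
  by rewrite es' count_cat count_elevate cp' ct'.
have ts j b := step_turn_component b p t n1.+1 j dp dt erefl; rewrite -es in ts.
have ts' j b := step_turn_component b (KL p) t' n1.+1 j dp' dt' (esym (congr1 S cp')).
rewrite -es' in ts'.
have t0 (q : seq bool) : is_dyck q -> (q != [::]) = (0 < count_mem true q).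
  by move/dyck_head; case: q => [|[] q].
have t0t : (t' != [::]) = (t != [::]) by rewrite !t0 ?ct'.
have cde j : j <= n1 -> cnt (step_turn false s) j = cnt (step_turn false p) j.
  by move=> le_j; apply: eq_cnt => i lt_i; rewrite ts subn0 ifT //; lia.
have cal j : j <= n1 -> cnt (step_turn true s) j = cnt (step_turn true p) j.-1.
  move=> le_j; rewrite -cnt_shift //; apply: eq_cnt => i lt_i.
  by rewrite ts subn1 ifT //; lia.
have [_ _ valid total] := dyck_step_turns p dp.
have ret_lt j : j < n1.+1 -> is_return s j = false.
  move=> lt_j; rewrite /is_return cal // cde; last lia.
  by apply/negbTE; rewrite -leqNgt.
have cm b k : t != [::] ->
    cnt (step_turn b s) (n1.+1 + k) = cnt (step_turn b p) n1 + 1 + cnt (step_turn b t) k.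
  move=> tn0; rewrite cntD cntS ts ltnn eqxx tn0; congr (_ + _ + _).
    case: (b); last exact: cde.
    rewrite cal // (cnt_support n1) ?(cnt_support n1 _ n1) ?leq_pred //;
    by move=> i /step_turn_lt.
  apply: eq_cnt => i lt_i; rewrite ts ifN ?ifN ?addKn //; lia.
have ret_ge k : t != [::] -> is_return s (n1.+1 + k) = (k == 0) || is_return t k.
  move=> tn0; rewrite /is_return cm //; case: k => [|k] /=.
    by rewrite addn0 /= cde // total /= addn1 ltnS leq_addr.
  by rewrite addnS /= cm // total ltn_add2l.
split.
- by rewrite es'; exact: dyck_elevate_cat.
- by rewrite cs' cs.
- move=> j lt_j; rewrite ts'; case: ltngtP => [lt_jm|lt_mj|ej].
  + rewrite ret_lt // orbF pu' subn1 ts subn0 ifT; last lia.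
    by case: (step_turn _ _ _); rewrite ?andbF ?andbT //; lia.
  + have tn0 : t != [::] by rewrite t0 //; lia.
    have [k ek] : exists k, j = n1.+1 + k.+1 by exists (j - n1.+1).-1; lia.
    rewrite ek addKn ret_ge // tu'; last lia.
    rewrite ts (_ : (n1.+1 + k.+1).-1 = n1.+1 + k); last lia.
    rewrite ifN; last lia.
    case: k ek => [|k] ek; first by rewrite addn0 eqxx tn0 andbF.
    rewrite ifN ?addKn; last lia.
    by rewrite (_ : 1 < n1.+1 + k.+2 = true) //; lia.
  + have tn0 : t != [::] by rewrite t0 //; lia.
    by have := ret_ge 0 tn0; rewrite addn0 ej t0t tn0 => ->; rewrite orbT.
- move=> j lt_j; rewrite ts'; case: ltngtP => [lt_jm|lt_mj|ej].
  + rewrite ret_lt // orbF pd' subn0 ts.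
    case: (ltngtP j.+1 n1.+1) => [lt_j1|?|ej1]; [|lia|]; last first.
    * have -> : 0 < j < n1 = false by lia.
      case: (eqVneq t [::]) => [t00|tn0]; rewrite ?andbF //= andbT.
      by apply/esym/negbTE; move: cs; rewrite t00 /=; lia.
    rewrite subn1 [j.+1.-1]/=; case: (step_turn _ _ _); rewrite ?andbF ?andbT //; lia.
  + have tn0 : t != [::] by rewrite t0 //; lia.
    have [k ek] : exists k, j = n1.+1 + k.+1 by exists (j - n1.+1).-1; lia.
    rewrite ek addKn ret_ge // td'; last lia.
    rewrite ts -addnS ifN; last lia.
    rewrite ifN ?addKn; last lia.
    by congr (_ && _ || _); lia.
  + have tn0 : t != [::] by rewrite t0 //; lia.
    by have := ret_ge 0 tn0; rewrite addn0 ej t0t tn0 => ->; rewrite orbT.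
Qed.

(** * The permutation and its order *)

Lemma dyck_size s : is_dyck s -> size s = (count_mem true s).*2.
Proof.
move=> /is_dyckP [e _]; rewrite -addnn [in X in _ + X]e.
by rewrite -(count_predC (pred1 true) s); congr (_ + _); apply: eq_count => -[].
Qed.

(** Substituting the complements given by [KLP] into [derivative_KLP] cancels the
negations; the returns of L(P) are the uncovered points of P. *)
Lemma derivative_KL_row s : is_dyck s ->
  let s' := derivative KL (KL s) in
  [/\ is_dyck s', size s' = size s
    & row_code (count_mem true s) (step_turn true s) (step_turn false s)
        (step_turn true s') (step_turn false s')].
Proof.
move=> ds s'; have [dt szt tu td] := KLP s ds.
have ct : count_mem true (KL s) = count_mem true s.
  by have := dyck_size _ dt; rewrite szt (dyck_size s ds) => /double_inj.
have [ds' cs' su sd] := derivative_KLP _ dt; rewrite -/s' ct in ds' cs' su sd.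
split=> //; first by rewrite !dyck_size // cs'.
set n := count_mem true s in ct cs' su sd tu td *.
have [al_lt de_lt _ _] := dyck_step_turns s ds; rewrite -/n in al_lt de_lt.
move=> j lt_j.
have ret : is_return (KL s) j = uncovered (step_turn true s) (step_turn false s) j.
  rewrite /is_return /uncovered.
  rewrite (eq_cnt _ _ j.-1 (fun i _ => td i)) (eq_cnt _ _ j (fun i _ => tu i)).
  have := cnt_compl n _ j de_lt; have := cnt_compl n _ j.-1 al_lt.
  by rewrite -/n; lia.
rewrite su // sd // ret td tu; split; congr (_ || _).
  case: j lt_j {ret} => [|[|j]] //= lt_j.
  by rewrite (_ : j.+1 < n = true) ?negbK //; lia.
case: (ltnP j n.-1) => lt_jn /=.
  by rewrite (_ : j.+1 < n = true) ?negbK //; lia.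
by apply/esym/negbTE/negP => /de_lt; lia.
Qed.

Lemma code_flow n (al de : nat -> nat -> bool) :
    (forall k, is_code n (al k) (de k)) ->
    (forall k, row_code n (al k) (de k) (al k.+1) (de k.+1)) ->
  rowmotion_flow n (fun k => covers (al k) (de k)).
Proof.
move=> cd row; split=> k.
- by rewrite /covers => a b ->.
- by move=> b; rewrite /covers.
- move=> a b le_ab le_nb; have [al_lt de_lt valid total] := cd k.
  rewrite /covers ltnNge le_ab /=; apply/negbTE; rewrite -leqNgt.
  rewrite (cnt_support n (al k)) //; last lia.
  have := total; rewrite (cnt_support n (al k)) ?leq_pred // => ->.
  case: (leqP a n) => [/leq_cnt //|/ltnW le_na].
  by rewrite (cnt_support n (de k) a) ?(cnt_support n (de k) n) //; lia.
- move=> a b /orP [lt_ba|lt_c]; first by rewrite /covers (leqW lt_ba).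
  by rewrite /covers (leq_trans lt_c) ?orbT ?leq_cnt.
- move=> a b /orP [lt_ba|lt_c]; first by rewrite /covers (ltnW lt_ba).
  by rewrite /covers (leq_ltn_trans _ lt_c) ?orbT // leq_cnt ?leq_pred.
- by move=> a b a_gt0 le_ab lt_bn; exact: covers_row (cd k) (row k) a b a_gt0 le_ab lt_bn.
Qed.

Lemma dyck_count n (p : dyck n) : count_mem true p = n.
Proof. by have := dyck_size p (dyckP p); rewrite size_tuple => /double_inj. Qed.

Lemma dyck_code n (p : dyck n) : is_code n (step_turn true p) (step_turn false p).
Proof. by have := dyck_step_turns _ (dyckP p); rewrite dyck_count. Qed.

Lemma dyck_eq n (p q : dyck n) :
  (forall b, step_turn b p =1 step_turn b q) -> p = q.
Proof.
move=> eq_pq; apply: val_inj; apply: val_inj => /=.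
have dp := dyckP p; have dq := dyckP q.
case: (posnP n) => [n0|n_gt0].
  have sz0 (r : dyck n) : tval (dyck_steps r) = [::].
    by apply: size0nil; rewrite size_tuple n0.
  by rewrite !sz0.
have ne0 (r : dyck n) : tval (dyck_steps r) != [::].
  by apply: contraTneq n_gt0 => e; rewrite -(dyck_count n r) e.
apply: turns_inj; first by rewrite !size_tuple.
  by rewrite (dyck_head _ dp) (dyck_head _ dq).
move=> b; have := eq_pq b; rewrite /step_turn.
have [lp [-> szp]] := dyck_turns_rcons b p dp (ne0 p).
have [lq [-> szq]] := dyck_turns_rcons b q dq (ne0 q).
have cb (r : dyck n) : count_mem b r = n.
  by have [e _] := is_dyckP _ (dyckP r); case: (b); rewrite -?e dyck_count.
rewrite !cb !dyck_count in szp szq * => eqj.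
congr rcons; apply: (@eq_from_nth _ false); rewrite szp ?szq // => i lt_i.
have := eqj i.+1; rewrite !nth_rcons szp szq lt_i /=.
by rewrite (_ : i.+1 < n = true) //; lia.
Qed.

Lemma size_rowmotion n (p : dyck n) : size (derivative KL (KL p)) == n.*2.
Proof. by have [_ -> _] := derivative_KL_row p (dyckP p); rewrite size_tuple. Qed.

Definition rowmotion n (p : dyck n) : dyck n :=
  @Dyck n (Tuple (size_rowmotion n p))
    (let: And3 d _ _ := derivative_KL_row p (dyckP p) in d).

Definition orbit_covers n (p : dyck n) (k : nat) : nat -> nat -> bool :=
  covers (step_turn true (iter k (@rowmotion n) p))
    (step_turn false (iter k (@rowmotion n) p)).

Lemma orbit_flow n (p : dyck n) : rowmotion_flow n (orbit_covers n p).
Proof.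
apply: (code_flow n (fun k => step_turn true (iter k (@rowmotion n) p))
  (fun k => step_turn false (iter k (@rowmotion n) p))) => k.
  exact: dyck_code.
by have [_ _] := derivative_KL_row _ (dyckP (iter k (@rowmotion n) p)); rewrite dyck_count.
Qed.

Lemma rowmotion_reflect n (p : dyck n) a b : a <= b -> b <= n ->
  orbit_covers n p n a b = orbit_covers n p 0 (n - b) (n - a).
Proof. exact: flow_reflect (orbit_flow n p). Qed.

Lemma rowmotion_period n (p : dyck n) : iter (2 * n) (@rowmotion n) p = p.
Proof.
have flow := orbit_flow n p.
have eqJ : orbit_covers n p (2 * n) =2 orbit_covers n p 0.
  move=> a b; case: (ltnP b a) => [lt_ba|le_ab]; first by rewrite !(flow_true _ _ flow).
  case: (leqP b n) => [le_bn|/ltnW le_nb]; last by rewrite !(flow_right _ _ flow).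
  have -> : orbit_covers n p (2 * n) = orbit_covers n (iter n (@rowmotion n) p) n.
    by rewrite /orbit_covers -iterD addnn mul2n.
  rewrite rowmotion_reflect // -[LHS]/(orbit_covers n p n (n - b) (n - a)).
  rewrite rowmotion_reflect; [|lia..].
  by congr (orbit_covers n p 0); lia.
have [] := covers_inj n _ _ _ _ (dyck_code n _) (dyck_code n _) eqJ.
by move=> eqal eqde; apply: dyck_eq => -[].
Qed.

(** The inverse is the power with exponent [2 * n - 1]. *)
Lemma rowmotion_inj n : injective (@rowmotion n).
Proof.
case: n => [|n]; last first.
  apply: (can_inj (g := iter (2 * n.+1).-1 (@rowmotion n.+1))) => p.
  by rewrite -iterSr rowmotion_period.
move=> p q _; apply: dyck_eq => b j; rewrite /step_turn.
have sz0 (r : dyck 0) : tval (dyck_steps r) = [::] by apply: size0nil; rewrite size_tuple.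
by rewrite !sz0.
Qed.

Lemma dyck_realize n al de : 0 < n -> is_code n al de ->
  exists p : dyck n, step_turn true p =1 al /\ step_turn false p =1 de.
Proof.
move=> n_gt0 /realize -/(_ n_gt0) [q [dq szq _ qu qd]].
by exists (@Dyck n (Tuple (introT eqP szq)) dq).
Qed.

(** The hypothesis on the turns says that [p] is u^n d^n. *)
Lemma rowmotion_orbit_large n (p : dyck n) k :
  (forall b j, ~~ step_turn b p j) -> 0 < k -> iter k (@rowmotion n) p = p -> n <= k.
Proof.
move=> p0 k_gt0 ek; rewrite leqNgt; apply/negP => lt_kn.
have cov0 a b : 0 < a <= b -> orbit_covers n p 0 a b = false.
  case/andP=> _ le_ab; rewrite /orbit_covers /covers ltnNge le_ab /=.
  rewrite [X in _ < X](eq_cnt _ (fun=> false)); last first.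
    by move=> j _; apply: negbTE; apply: p0.
  by rewrite /cnt count_pred0 ltn0.
have := flow_from_empty n _ k 1 1 (orbit_flow n p) cov0 lt_kn isT isT (ltac:(lia)).
have -> : orbit_covers n p k 1 1 = orbit_covers n p 0 1 1 by rewrite /orbit_covers ek.
by rewrite cov0 //; lia.
Qed.

(** The path with A = D = {1}, whose reflection has A = D = {n - 1}. *)
Lemma rowmotion_half_neq n : 2 < n -> exists p : dyck n, iter n (@rowmotion n) p <> p.
Proof.
move=> n_gt2; pose f j := j == 1.
have [|p [pu pd]] := dyck_realize n f f (ltac:(lia)).
  by split=> // j /eqP ->; lia.
exists p => e; have := rowmotion_reflect n p 1 1 isT (ltac:(lia)).
rewrite /orbit_covers e /= /covers ltnn /=.
rewrite !(eq_cnt _ f _ (fun j _ => pu j)) !(eq_cnt _ f _ (fun j _ => pd j)).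
have f_lt j : f j -> 0 < j < 2 by move/eqP->.
have f1 m : 0 < m -> cnt f m = 1 by move=> m_gt0; rewrite (cnt_support 2 f m).
by rewrite !(f1 (n - _)) ?(f1 (n - _).-1) ?ltnn //; lia.
Qed.

Theorem mainTheorem3 (n : nat) (hn : 3 <= n) :
  exists s : {perm dyck n},
    (forall p : dyck n, (s p : seq bool) = (derivative KL \o KL) p) /\
    #[s]%g = 2 * n.
Proof.
exists (perm (rowmotion_inj n)); split=> [p|]; first by rewrite permE.
set s := perm _.
have sX k p : (s ^+ k)%g p = iter k (@rowmotion n) p.
  by rewrite permX; apply: eq_iter => q; rewrite permE.
have dvd2n : #[s]%g %| 2 * n.
  by rewrite order_dvdn; apply/eqP/permP => p; rewrite sX rowmotion_period perm1.
have ndvdn : ~~ (#[s]%g %| n).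
  rewrite order_dvdn; apply/negP => /eqP sn1.
  by have [p] := rowmotion_half_neq n hn; rewrite -sX sn1 perm1.
have [|e [eu ed]] := dyck_realize n (fun=> false) (fun=> false) (ltac:(lia)).
  by [].
have le_n : n <= #[s]%g.
  apply: (rowmotion_orbit_large n e); rewrite ?order_gt0 //.
    by case=> j; rewrite ?eu ?ed.
  by rewrite -sX expg_order perm1.
(* the quotient of 2 * n by the order is 1 or 2, and 2 is excluded *)
case/dvdnP: dvd2n => -[|[|[|c]]] ec; [lia | by rewrite ec mul1n | | nia].
have eo : n = #[s]%g by lia.
by rewrite [X in _ %| X]eo dvdnn in ndvdn.
Qed.
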